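(* Let $Fm_m$ be the set of formulas of basic modal propositional logic and define, for $\varphi,\psi\in Fm_m$, $\varphi\equiv\psi:=\square(\varphi\rightarrow\psi)\wedge\square(\psi\rightarrow\varphi)$. Then for all $\varphi,\psi,\psi'\in Fm_m$ and every variable $x$ occurring in $\varphi$, the following are theorems of the modal system $S3$: $\varphi\equiv\varphi$; $(\varphi\equiv\psi)\rightarrow(\varphi\rightarrow\psi)$; $(\psi\equiv\psi')\rightarrow(\varphi[x:=\psi]\equiv\varphi[x:=\psi'])$. That is, propositional identity is definable by strict equivalence in $S3$.
   Context: $Fm_m$ is the set of formulas built from a countable set $V$ of propositional variables and the constants $\bot,\top$ by the connectives $\neg,\rightarrow,\vee,\wedge$ and the modal operator $\square$; $\varphi[x:=\psi]$ denotes the result of replacing every occurrence of the variable $x$ in $\varphi$ by $\psi$. The modal system $S3$ (Lemmon-style) has as axioms all substitution instances (in $Fm_m$) of classical propositional tautologies and all instances of $\square\varphi\rightarrow\varphi$, $\square(\varphi\rightarrow\psi)\rightarrow(\square\varphi\rightarrow\square\psi)$, $\square(\varphi\rightarrow\psi)\rightarrow\square(\square\varphi\rightarrow\square\psi)$; its rules are Modus Ponens and Axiom Necessitation (from an axiom $\varphi$ infer $\square\varphi$). *)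

(* Defs.v *)
From mathcomp Require Import all_boot.

Set Implicit Arguments.
Unset Strict Implicit.
Unset Printing Implicit Defensive.

(* The countable set V of propositional variables is taken to be nat. *)
Inductive fm : Type :=
| Var of nat
| Bot
| Top
| Neg of fm
| Imp of fm & fm
| Or of fm & fm
| And of fm & fm
| Box of fm.

Declare Scope fm_scope.
Delimit Scope fm_scope with fm.
Bind Scope fm_scope with fm.

Notation "⊥" := Bot (at level 0) : fm_scope.
Notation "⊤" := Top (at level 0) : fm_scope.
Notation "¬ p" := (Neg p) (at level 35, right associativity) : fm_scope.
Notation "□ p" := (Box p) (at level 35, right associativity) : fm_scope.
Notation "p ∧ q" := (And p q) (at level 40, left associativity) : fm_scope.
Notation "p ∨ q" := (Or p q) (at level 50, left associativity) : fm_scope.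
Notation "p → q" := (Imp p q) (at level 60, right associativity) : fm_scope.

Definition strict_equiv (p q : fm) : fm := (□ (p → q) ∧ □ (q → p))%fm.
Notation "p ≡ q" := (strict_equiv p q) (at level 55, no associativity) : fm_scope.

Fixpoint occurs (x : nat) (p : fm) : bool :=
  match p with
  | Var y => y == x
  | Bot | Top => false
  | Neg q | Box q => occurs x q
  | Imp q r | Or q r | And q r => occurs x q || occurs x r
  end.

Fixpoint subst (p : fm) (x : nat) (q : fm) : fm :=
  match p with
  | Var y => if y == x then q else Var y
  | Bot => Bot
  | Top => Top
  | Neg r => Neg (subst r x q)
  | Imp r s => Imp (subst r x q) (subst s x q)
  | Or r s => Or (subst r x q) (subst s x q)
  | And r s => And (subst r x q) (subst s x q)
  | Box r => Box (subst r x q)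
  end.

Notation "p [[ x := q ]]" := (subst p x q)
  (at level 2, left associativity, x at level 99, q at level 99,
   format "p [[ x  :=  q ]]") : fm_scope.

(* Modality-free formulas, used only to speak of classical tautologies. *)
Inductive pfm : Type :=
| PVar of nat
| PBot
| PTop
| PNeg of pfm
| PImp of pfm & pfm
| POr of pfm & pfm
| PAnd of pfm & pfm.

Fixpoint eval (v : nat -> bool) (a : pfm) : bool :=
  match a with
  | PVar y => v y
  | PBot => false
  | PTop => true
  | PNeg b => ~~ eval v b
  | PImp b c => eval v b ==> eval v c
  | POr b c => eval v b || eval v c
  | PAnd b c => eval v b && eval v c
  end.

Definition tautology (a : pfm) : Prop := forall v : nat -> bool, eval v a.

Fixpoint inst (s : nat -> fm) (a : pfm) : fm :=
  match a with
  | PVar y => s y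
  | PBot => Bot
  | PTop => Top
  | PNeg b => Neg (inst s b)
  | PImp b c => Imp (inst s b) (inst s c)
  | POr b c => Or (inst s b) (inst s c)
  | PAnd b c => And (inst s b) (inst s c)
  end.

Inductive S3_axiom : fm -> Prop :=
| ax_taut (s : nat -> fm) (a : pfm) : tautology a -> S3_axiom (inst s a)
| ax_T (p : fm) : S3_axiom (□ p → p)
| ax_K (p q : fm) : S3_axiom (□ (p → q) → (□ p → □ q))
| ax_S3 (p q : fm) : S3_axiom (□ (p → q) → □ (□ p → □ q)).

Inductive S3_theorem : fm -> Prop :=
| S3_ax (p : fm) : S3_axiom p -> S3_theorem p
| S3_MP (p q : fm) : S3_theorem (p → q) -> S3_theorem p -> S3_theorem q
| S3_AN (p : fm) : S3_axiom p -> S3_theorem (□ p).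

(* Main.v *)
(** Strict implication is a congruence under a fixed hypothesis [h]: the
    Boolean connectives are handled by necessitated tautologies and axiom K,
    and the box by the S3 axiom [□(p → q) → □(□p → □q)]. Since negation and
    the left side of an implication are antitone, the induction on the formula
    quantifies over both replaced formulas, so that they can be swapped. *)
Require Import Defs.
From mathcomp Require Import all_boot.

Set Implicit Arguments.
Unset Strict Implicit.
Unset Printing Implicit Defensive.

Local Open Scope fm_scope.

(** The substitution is given as a list: variable [i] is sent to entry [i], so each use matches its
    goal by computation. The default [Bot] is harmless, as any instance of a tautology is an
    axiom. *)
Lemma taut_inst (l : seq fm) (a : pfm) :
  tautology a -> S3_axiom (inst (nth Bot l) a).
Proof. exact: ax_taut. Qed.

Ltac tautology_by_cases :=
  let v := fresh "v" in intro v; simpl;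
  by repeat match goal with |- context [v ?n] => case: (v n) end.

Local Notation P0 := (PVar 0).
Local Notation P1 := (PVar 1).
Local Notation P2 := (PVar 2).
Local Notation P3 := (PVar 3).

Lemma S3_id p : S3_axiom (p → p).
Proof. by apply: (@taut_inst [:: p] (PImp P0 P0)); tautology_by_cases. Qed.

Lemma S3_weaken h p : S3_theorem p -> S3_theorem (h → p).
Proof.
apply: S3_MP; apply: S3_ax.
by apply: (@taut_inst [:: p; h] (PImp P0 (PImp P1 P0))); tautology_by_cases.
Qed.

(** This stands in for the deduction theorem: it lets later arguments run under the hypothesis
    [h]. *)
Lemma S3_MP_under h p q :
  S3_theorem (h → p → q) -> S3_theorem (h → p) -> S3_theorem (h → q).
Proof.
move=> hpq; apply: S3_MP; apply: S3_MP hpq; apply: S3_ax.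
apply: (@taut_inst [:: h; p; q]
  (PImp (PImp P0 (PImp P1 P2)) (PImp (PImp P0 P1) (PImp P0 P2)))).
by tautology_by_cases.
Qed.

Lemma S3_trans p q r :
  S3_theorem (p → q) -> S3_theorem (q → r) -> S3_theorem (p → r).
Proof. by move=> pq qr; apply: S3_MP_under pq; apply: S3_weaken. Qed.

Lemma S3_andl p q : S3_theorem (p ∧ q → p).
Proof.
by apply: S3_ax; apply: (@taut_inst [:: p; q] (PImp (PAnd P0 P1) P0));
  tautology_by_cases.
Qed.

Lemma S3_andr p q : S3_theorem (p ∧ q → q).
Proof.
by apply: S3_ax; apply: (@taut_inst [:: p; q] (PImp (PAnd P0 P1) P1));
  tautology_by_cases.
Qed.

Lemma S3_and p q : S3_theorem (p → q → p ∧ q).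
Proof.
apply: S3_ax.
apply: (@taut_inst [:: p; q] (PImp P0 (PImp P1 (PAnd P0 P1)))).
by tautology_by_cases.
Qed.

(** The implication is required to be an axiom because necessitation in S3 applies to axioms
    only. *)
Lemma S3_box_under h p q :
  S3_axiom (p → q) -> S3_theorem (h → □ p) -> S3_theorem (h → □ q).
Proof.
move=> pq hp; apply: (S3_trans hp).
by apply: (S3_MP (S3_ax (ax_K p q))); apply: S3_AN.
Qed.

Lemma S3_box2_under h p q r : S3_axiom (p → q → r) ->
  S3_theorem (h → □ p) -> S3_theorem (h → □ q) -> S3_theorem (h → □ r).
Proof.
move=> pqr hp; apply: S3_MP_under.
by apply: S3_trans (S3_ax (ax_K q r)); apply: S3_box_under hp.
Qed.

Lemma S3_subst_strict_imp h p x q q' :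
  S3_theorem (h → □ (q → q')) -> S3_theorem (h → □ (q' → q)) ->
  S3_theorem (h → □ (p[[x := q]] → p[[x := q']])).
Proof.
elim: p q q' => [y | | | p IHp | p1 IH1 p2 IH2 | p1 IH1 p2 IH2
  | p1 IH1 p2 IH2 | p IHp] q q' qq' q'q /=.
(* If the variable is [x], the goal is the first hypothesis; otherwise substitution leaves it
   unchanged. *)
- case: ifP => // _.
  by apply/S3_weaken/S3_AN/S3_id.
- by apply/S3_weaken/S3_AN/S3_id.
- by apply/S3_weaken/S3_AN/S3_id.
- apply: S3_box_under (IHp _ _ q'q qq').
  apply: (@taut_inst [:: p[[x := q']]; p[[x := q]]]
    (PImp (PImp P0 P1) (PImp (PNeg P1) (PNeg P0)))).
  by tautology_by_cases.
- apply: S3_box2_under (IH1 _ _ q'q qq') (IH2 _ _ qq' q'q).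
  (* The tautology chains the swapped implication between antecedents, the assumed implication, and
     the one between consequents. *)
  apply: (@taut_inst
    [:: p1[[x := q']]; p1[[x := q]]; p2[[x := q]]; p2[[x := q']]]
    (PImp (PImp P0 P1) (PImp (PImp P2 P3)
      (PImp (PImp P1 P2) (PImp P0 P3))))).
  by tautology_by_cases.
- apply: S3_box2_under (IH1 _ _ qq' q'q) (IH2 _ _ qq' q'q).
  apply: (@taut_inst
    [:: p1[[x := q]]; p1[[x := q']]; p2[[x := q]]; p2[[x := q']]]
    (PImp (PImp P0 P1) (PImp (PImp P2 P3)
      (PImp (POr P0 P2) (POr P1 P3))))).
  by tautology_by_cases.
- apply: S3_box2_under (IH1 _ _ qq' q'q) (IH2 _ _ qq' q'q).
  apply: (@taut_inst
    [:: p1[[x := q]]; p1[[x := q']]; p2[[x := q]]; p2[[x := q']]]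
    (PImp (PImp P0 P1) (PImp (PImp P2 P3)
      (PImp (PAnd P0 P2) (PAnd P1 P3))))).
  by tautology_by_cases.
- exact: S3_trans (IHp _ _ qq' q'q) (S3_ax (ax_S3 _ _)).
Qed.

Local Close Scope fm_scope.

Theorem theorem31 (p q q' : fm) :
  [/\ S3_theorem (p ≡ p)%fm,
      S3_theorem ((p ≡ q) → (p → q))%fm
    & forall x : nat, occurs x p ->
        S3_theorem ((q ≡ q') → (p[[x := q]] ≡ p[[x := q']]))%fm].
Proof.
split.
- have bid := S3_AN (S3_id p).
  exact: S3_MP (S3_MP (S3_and _ _) bid) bid.
- exact: S3_trans (S3_andl _ _) (S3_ax (ax_T _)).
- move=> x _; have qq' := S3_andl (Box (Imp q q')) (Box (Imp q' q)).
  have q'q := S3_andr (Box (Imp q q')) (Box (Imp q' q)).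
  (* With [h] taken to be the strict equivalence itself, swapping its two projections yields the
     converse conjunct. *)
  apply: S3_MP_under (S3_subst_strict_imp p x q'q qq').
  exact: S3_trans (S3_subst_strict_imp p x qq' q'q) (S3_and _ _).
Qed.
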